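(* Assume that $f$ is continuous on $\mathcal{I}=[0,1]$ and $\inf_{x\in\mathcal{I}} f(x)>0$. For each $n$, let $\widetilde{w}_1,\ldots,\widetilde{w}_n$ be weight functions on $\mathcal{I}$ that depend solely on $X_1,\ldots,X_n$ and satisfy $\sum_{j=1}^n \widetilde{w}_j(x)=1$ for all $x$, and define the updated weight functions $$\hat{w}_j(x)=w_j(x)+\widetilde{w}_j(x)-\sum_{i=1}^n w_i(x)\,\widetilde{w}_j(X_i),\qquad j=1,\ldots,n,$$ where $w_i(x)=K_h(X_i-x)/\sum_{k=1}^n K_h(X_k-x)$ are the Nadaraya--Watson weights. If $$\sup_{x\in\mathcal{I}}\sum_{j=1}^n \widetilde{w}_j(x)^2=O_p(n^{-1}h^{-1}),$$ then $$\sup_{x\in\mathcal{I}}\sum_{j=1}^n \hat{w}_j(x)^2=O_p(n^{-1}h^{-1}).$$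
   Context: $X_1,\ldots,X_n$ are independent and identically distributed real random covariates with marginal density $f$ supported on $\mathcal{I}=[0,1]$. The kernel $K$ is a symmetric probability density function which is Lipschitz continuous and supported on $[-1,1]$. The bandwidth $h=h_n>0$ is a deterministic sequence with $h\to0$ and $nh/\log n\to\infty$ as $n\to\infty$, and $K_h(u)=K(u/h)/h$. $O_p$ is as $n\to\infty$. Interpretation: for data $(X_i,Y_i)$, a pre-estimate $\widetilde{m}(x)=\sum_j\widetilde{w}_j(x)Y_j$ of the regression function is updated by one step of $L_2$ boosting, $\hat{m}(x)=\widetilde{m}(x)+\sum_{i=1}^n w_i(x)[Y_i-\widetilde{m}(X_i)]=\sum_{j=1}^n\hat{w}_j(x)Y_j$. *)

(* Defs.v *)
From HB Require Import structures.
From mathcomp Require Export all_boot all_order all_algebra.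
From mathcomp Require Export all_classical all_reals all_analysis.

Set Implicit Arguments.
Unset Strict Implicit.
Unset Printing Implicit Defensive.

Import Order.TTheory GRing.Theory Num.Theory.
Import numFieldNormedType.Exports.

Local Open Scope classical_set_scope.
Local Open Scope ring_scope.

Definition is_pdf (R : realType) (g : R -> R) : Prop :=
  [/\ measurable_fun setT g, forall x, 0 <= g x &
      (\int[lebesgue_measure]_x (g x)%:E = 1)%E].

Definition has_density d (T : measurableType d) (R : realType)
    (P : probability T R) (X : {RV P >-> R}) (f : R -> R) : Prop :=
  is_pdf f /\
  forall A : set R, measurable A ->
    distribution P X A = (\int[lebesgue_measure]_(x in A) (f x)%:E)%E.

(* Mutual independence: the product rule over every finite subfamily. *)
Definition independent_RVs d (T : measurableType d) (R : realType)
    (P : probability T R) (X : nat -> {RV P >-> R}) : Prop :=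
  forall (J : seq nat) (A : nat -> set R), uniq J ->
    (forall i, measurable (A i)) ->
    P (\big[setI/setT]_(i <- J) (X i @^-1` A i)) =
    (\prod_(i <- J) P (X i @^-1` A i))%E.

(* Z n = O_p(a n). The variables are extended-real so that a supremum over an
   unbounded set is +oo. No measurability of Z n is required: the probability
   is the outer probability P^*, which is P on measurable sets. *)
Definition bigO_p d (T : measurableType d) (R : realType)
    (P : probability T R) (Z : nat -> T -> \bar R) (a : nat -> R) : Prop :=
  forall eps : R, 0 < eps -> exists2 M : R, 0 < M &
    \forall n \near \oo,
      ((P^*)%mu [set o | (M * a n)%:E < `|Z n o|] <= eps%:E)%E.

Definition scaled_kernel (R : realType) (K : R -> R) (h u : R) : R :=
  K (u / h) / h.

(* Where the denominator vanishes all the weights are 0, since 0^-1 = 0. *)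
Definition nw_weight (R : realType) (K : R -> R) (h : R) (n : nat)
    (v : 'I_n -> R) (i : 'I_n) (x : R) : R :=
  scaled_kernel K h (v i - x) / \sum_(k < n) scaled_kernel K h (v k - x).

Definition boosted_weight (R : realType) (K : R -> R) (h : R) (n : nat)
    (v : 'I_n -> R) (w : 'I_n -> R -> R) (j : 'I_n) (x : R) : R :=
  nw_weight K h v j x + w j x - \sum_(i < n) nw_weight K h v i x * w j (v i).

Definition sup_sum_sq (R : realType) (n : nat) (w : 'I_n -> R -> R) : \bar R :=
  ereal_sup [set (\sum_(j < n) w j x ^+ 2)%:E | x in `[0%R, 1%R]].

(* Main.v *)
Require Import Defs.
From HB Require Import structures.
From mathcomp Require Import all_boot all_order all_algebra.
From mathcomp Require Import all_classical all_reals all_analysis.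
From mathcomp Require Import ring lra.

Set Implicit Arguments.
Unset Strict Implicit.
Unset Printing Implicit Defensive.

Import Order.TTheory GRing.Theory Num.Theory.
Import numFieldNormedType.Exports.

Local Open Scope classical_set_scope.
Local Open Scope ring_scope.

(** Everything reduces to one probabilistic fact: with probability tending to 1,
    the denominators [\sum_k K_h(X_k - x)] of the Nadaraya-Watson weights are at
    least [a * n] for all [x] in [0, 1] at once, for some fixed [a > 0].

    Given this fact, the bound is deterministic. The weights [w_i(x)] are
    nonnegative with sum at most 1, so [\sum_i w_i(x)^2] is at most
    [max_i w_i(x) <= sup K / (h a n)], and by Jensen's inequality
    [\sum_j (\sum_i w_i(x) wt_j(X_i))^2 <= \sum_i w_i(x) \sum_j wt_j(X_i)^2],
    where [wt] stands for the weights before the boosting step; the right-hand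
    side is at most [sup_y \sum_j wt_j(y)^2] because the [X_i] lie in [0, 1]
    almost surely. Then [(a + b - c)^2 <= 3 (a^2 + b^2 + c^2)] concludes; see
    [sum_sqr_boosted_weight_le].

    For the denominators ([nw_denominator_whp]), [K] exceeds some [kappa > 0] on
    the balls of radius [delta] around two symmetric points [u0] and [- u0]. The
    interval [0, 1] is cut into about [1 / (delta h)] cells. For each [x], one of
    [x + h u0] and [x - h u0] lies in [0, 1], and every [X_k] in the cell of that
    point contributes at least [kappa / h] to the denominator at [x]. A cell has
    probability at least a constant times [h], so by a Chernoff bound
    ([hits_lower_tail]) it contains at most [g n h] sample points with
    probability at most [expR (- g n h)]. The number of cells is [O(n)] and
    [g n h >= 2 ln n] eventually, so the union bound over the cells tends to 0.

    Only finitely many cells are involved, so the events to control are covered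
    by finite unions of measurable sets, and outer probabilities suffice. *)

(** * A Chernoff bound from the product rule *)

Lemma measure_bigsetU_le d (T : measurableType d) (R : realType)
    (mu : {measure set T -> \bar R}) (I : Type) (r : seq I) (Q : pred I)
    (E : I -> set T) :
  (forall i, measurable (E i)) ->
  (mu (\big[setU/set0]_(i <- r | Q i) E i) <= \sum_(i <- r | Q i) mu (E i))%E.
Proof.
move=> mE.
suff [] : measurable (\big[setU/set0]_(i <- r | Q i) E i) /\
  (mu (\big[setU/set0]_(i <- r | Q i) E i) <= \sum_(i <- r | Q i) mu (E i))%E by [].
elim/big_rec2: _ => [|i v A _ [mA le_Av]]; first by rewrite measure0.
split; first exact: measurableU.
by rewrite (le_trans (measureU2 _ _ _))// leeD2l.
Qed.

Definition hits d (T : measurableType d) (R : realType) (P : probability T R)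
    (X : nat -> {RV P >-> R}) (n : nat) (A : set R) (o : T) : R :=
  \sum_(i < n) (X i o \in A)%:R.

(** Complements are allowed as factors in the product rule, so the law of the
    whole vector of indicators is explicit. This replaces any appeal to the
    expectation of a product of independent variables. *)
Lemma independent_pattern d (T : measurableType d) (R : realType)
    (P : probability T R) (X : nat -> {RV P >-> R}) (n : nat) (A : set R)
    (s : {ffun 'I_n -> bool}) :
  independent_RVs X -> measurable A ->
  P (\big[setI/setT]_(i < n) (X i @^-1` (if s i then A else ~` A))) =
  (\prod_(i < n) (if s i then fine (P (X i @^-1` A))
                  else 1 - fine (P (X i @^-1` A))))%:E.
Proof.
move=> indep mA.
have mXA i : measurable (X i @^-1` A) by rewrite -[_ @^-1` _]setTI; exact: measurable_funP.
(* Independence speaks of families indexed by nat: extend s by false. *)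
pose B (k : nat) := if oapp s false (insub k) then A else ~` A.
have BE (i : 'I_n) : B i = if s i then A else ~` A by rewrite /B valK.
have mB k : measurable (B k) by rewrite /B; case: ifP => _ //; exact: measurableC.
have := indep (index_iota 0 n) B (iota_uniq _ _) mB.
rewrite !big_mkord => indepE.
under eq_bigr do rewrite -BE.
rewrite indepE -prodEFin; apply: eq_bigr => i _.
rewrite BE; case: ifP => _; first by rewrite /= fineK ?fin_num_measure.
rewrite preimage_setC probability_setC; last exact: mXA.
by rewrite EFinB fineK ?fin_num_measure.
Qed.

(** Chernoff's method with the generating function evaluated at 1/2: a pattern
    with [j <= t] hits has [1 <= expR t * (1 / 2) ^ j], and
    [\sum_s \prod_i] of the reweighted pattern probabilities factors as
    [\prod_i (1 - q_i / 2)], which is at most [expR (- n p / 2)]. *)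
Lemma hits_lower_tail d (T : measurableType d) (R : realType)
    (P : probability T R) (X : nat -> {RV P >-> R}) (n : nat) (A : set R)
    (p t : R) :
  independent_RVs X -> measurable A ->
  (forall i, p%:E <= P (X i @^-1` A))%E ->
  ((P^*)%mu [set o | (hits X n A o <= t)%R] <= (expR (t - n%:R * p / 2))%:E)%E.
Proof.
move=> indep mA pP.
have mXA i : measurable (X i @^-1` A) by rewrite -[_ @^-1` _]setTI; exact: measurable_funP.
pose q (i : 'I_n) := fine (P (X i @^-1` A)).
have q0 i : 0 <= q i by rewrite fine_ge0.
have q1 i : q i <= 1.
  by rewrite -lee_fin fineK ?fin_num_measure// probability_le1.
have qp i : p <= q i by rewrite -lee_fin fineK ?fin_num_measure// pP.
pose E (s : {ffun 'I_n -> bool}) :=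
  \big[setI/setT]_(i < n) (X i @^-1` (if s i then A else ~` A)).
have mE s : measurable (E s).
  apply: bigsetI_measurable => i _; case: (s i) => //.
  by rewrite preimage_setC; apply: measurableC; exact: mXA.
pose few (s : {ffun 'I_n -> bool}) := \sum_(i < n) (s i)%:R <= t.
have cover : [set o | hits X n A o <= t] `<=` \big[setU/set0]_(s | few s) E s.
  move=> o /= le_t; rewrite -bigcup_seq_cond.
  exists [ffun i : 'I_n => X i o \in A].
    rewrite /= mem_index_enum /few.
    by under eq_bigr do rewrite ffunE.
  rewrite /E -bigcap_seq => i _; rewrite /= ffunE.
  by case: (boolP (X i o \in A)) => [/set_mem|/negP XA]// ?; apply: XA; exact: mem_set.
apply: (le_trans (le_mu_ext P cover)).
have mU : measurable (\big[setU/set0]_(s | few s) E s) by exact: bigsetU_measurable.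
rewrite measurable_mu_extE//.
apply: (le_trans (measure_bigsetU_le P _ _ mE)).
rewrite (eq_bigr _ (fun s _ => independent_pattern s indep mA)).
rewrite sumEFin lee_fin.
pose g (i : 'I_n) (b : bool) := if b then q i / 2 else 1 - q i.
have g0 i b : 0 <= g i b.
  by rewrite /g; case: b; [rewrite divr_ge0 | rewrite subr_ge0].
(* Dropping the constraint on the number of hits makes the sum factor. *)
apply: (@le_trans _ _ (\sum_(s : {ffun 'I_n -> bool}) expR t * \prod_i g i (s i))).
  rewrite [leRHS](bigID few)/= -[leLHS]addr0 lerD//; last first.
    by apply: sumr_ge0 => s _; rewrite mulr_ge0 ?expR_ge0// prodr_ge0.
  apply: ler_sum => s s_few.
  have -> : \prod_(i < n) (if s i then fine (P (X i @^-1` A))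
                else 1 - fine (P (X i @^-1` A))) =
      \prod_(i < n) (if s i then 2 else 1) * \prod_i g i (s i).
    rewrite -big_split/=; apply: eq_bigr => i _; rewrite /g /q.
    by case: (s i); [field | rewrite mul1r].
  apply: ler_wpM2r; first by rewrite prodr_ge0.
  apply: (le_trans _ (_ : expR (\sum_(i < n) (s i)%:R) <= _)); last by rewrite ler_expR.
  (* Each hit costs a factor 2, paid for by 2 <= expR 1. *)
  rewrite expR_sum; apply: ler_prod => i _; case: (s i) => /=.
    by rewrite ler0n/= (le_trans _ (expR_ge1Dx 1)).
  by rewrite ler01 expR0 lexx.
rewrite -mulr_sumr -(bigA_distr_bigA g) expRD ler_wpM2l ?expR_ge0//.
apply: (@le_trans _ _ (\prod_(i < n) expR (- p / 2))).
  apply: ler_prod => i _; rewrite big_bool /g/= addr_ge0 ?(g0 i true) ?(g0 i false)//=.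
  apply: (le_trans _ (expR_ge1Dx _)).
  by have := qp i; lra.
rewrite -expR_sum sumr_const card_ord -mulr_natl ler_expR.
by lra.
Qed.

(** * The deterministic bound on the updated weights *)

(** Jensen's inequality for the square and weights of total mass at most 1, by
    expanding the nonnegative sum [\sum_i a_i (z_i - m)^2] where [m] is the
    weighted sum. Mass below 1 is harmless since the square vanishes at 0. *)
Lemma sqr_wmean_le (R : realDomainType) (I : finType) (a z : I -> R) :
  (forall i, 0 <= a i) -> \sum_i a i <= 1 ->
  (\sum_i a i * z i) ^+ 2 <= \sum_i a i * z i ^+ 2.
Proof.
move=> a0 a1; set m := \sum_i a i * z i.
have : 0 <= \sum_i a i * (z i - m) ^+ 2.
  by apply: sumr_ge0 => i _; rewrite mulr_ge0// sqr_ge0.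
have -> : \sum_i a i * (z i - m) ^+ 2 =
    \sum_i a i * z i ^+ 2 - 2 * m * m + (\sum_i a i) * m ^+ 2.
  rewrite {3}/m mulr_sumr mulr_suml -sumrB -big_split/=.
  by apply: eq_bigr => i _; ring.
have : (\sum_i a i) * m ^+ 2 <= m ^+ 2 by rewrite ler_piMl// sqr_ge0.
lra.
Qed.

Section nw_weights.
Variables (R : realType) (K : R -> R) (h : R) (n : nat) (v : 'I_n -> R).
Hypotheses (K_ge0 : forall u, 0 <= K u) (h_gt0 : 0 < h).

Let D x := \sum_(k < n) scaled_kernel K h (v k - x).

Lemma scaled_kernel_ge0 u : 0 <= scaled_kernel K h u.
Proof. by rewrite divr_ge0// ltW. Qed.

Lemma nw_weight_ge0 i x : 0 <= nw_weight K h v i x.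
Proof.
by rewrite divr_ge0 ?scaled_kernel_ge0// sumr_ge0// => k _; exact: scaled_kernel_ge0.
Qed.

Lemma sum_nw_weight_le1 x : \sum_(i < n) nw_weight K h v i x <= 1.
Proof.
rewrite -mulr_suml -/(D x); have [->|D0] := eqVneq (D x) 0; first by rewrite mul0r.
by rewrite divff.
Qed.

(** A sum of squares is at most the largest weight times the total weight. *)
Lemma sum_sqr_nw_weight_le (B m x : R) :
  (forall u, K u <= B) -> 0 < m -> m <= D x ->
  \sum_(i < n) nw_weight K h v i x ^+ 2 <= B / (h * m).
Proof.
move=> KB m0 mD.
have wle i : nw_weight K h v i x <= B / (h * m).
  rewrite invfM mulrA ler_pM ?scaled_kernel_ge0//.
  - by rewrite invr_ge0 (le_trans (ltW m0) mD).
  - by rewrite ler_pM2r ?invr_gt0.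
  - by rewrite lef_pV2// posrE ?(lt_le_trans m0 mD).
have b0 : 0 <= B / (h * m).
  by rewrite divr_ge0 ?(le_trans (K_ge0 0) (KB 0))// mulr_ge0// ltW.
apply: (@le_trans _ _ (\sum_(i < n) B / (h * m) * nw_weight K h v i x)).
  by apply: ler_sum => i _; rewrite expr2 ler_wpM2r ?nw_weight_ge0.
by rewrite -mulr_sumr ler_piMr// sum_nw_weight_le1.
Qed.

(** The three terms of the updated weight are treated separately. The smoothed
    one is a weighted mean over the sample points, so that Jensen's inequality
    bounds its sum of squares by a mean of values already bounded by [S]; this is
    where the sample points have to lie in [0, 1]. *)
Lemma sum_sqr_boosted_weight_le (w : 'I_n -> R -> R) (B m S x : R) :
  (forall i, 0 <= v i <= 1) ->
  (forall y, 0 <= y <= 1 -> \sum_(j < n) w j y ^+ 2 <= S) ->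
  (forall u, K u <= B) -> 0 < m -> 0 <= x <= 1 -> m <= D x ->
  \sum_(j < n) boosted_weight K h v w j x ^+ 2 <= 3 * (B / (h * m)) + 6 * S.
Proof.
move=> v01 wS KB m0 x01 mD.
set a := fun i => nw_weight K h v i x.
have S0 : 0 <= S.
  by apply: le_trans (wS x x01); apply: sumr_ge0 => j _; exact: sqr_ge0.
have smoothed : \sum_(j < n) (\sum_(i < n) a i * w j (v i)) ^+ 2 <= S.
  apply: (@le_trans _ _ (\sum_(i < n) a i * \sum_(j < n) w j (v i) ^+ 2)).
    under [leRHS]eq_bigr do rewrite mulr_sumr.
    rewrite exchange_big/=; apply: ler_sum => j _.
    by apply: sqr_wmean_le => [i|]; [exact: nw_weight_ge0 | exact: sum_nw_weight_le1].
  apply: (@le_trans _ _ (\sum_(i < n) a i * S)).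
    by apply: ler_sum => i _; rewrite ler_wpM2l ?nw_weight_ge0// wS.
  by rewrite -mulr_suml ler_piMl// sum_nw_weight_le1.
apply: (@le_trans _ _ (3 * (\sum_(j < n) a j ^+ 2 + \sum_(j < n) w j x ^+ 2
    + \sum_(j < n) (\sum_(i < n) a i * w j (v i)) ^+ 2))).
  rewrite -!big_split mulr_sumr/=; apply: ler_sum => j _.
  rewrite /boosted_weight -/(a j); set b := w j x; set c := \sum_(i < n) _.
  have := sqr_ge0 (a j - b); have := sqr_ge0 (a j + c); have := sqr_ge0 (b + c).
  by rewrite !expr2; lra.
have := sum_sqr_nw_weight_le KB m0 mD; have := wS x x01.
rewrite -/(a _) => le1 le2; rewrite -/a in le2.
lra.
Qed.

End nw_weights.

Lemma nw_denominator_ge (R : realType) (K : R -> R) (h kappa x : R)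
    (n : nat) (v : 'I_n -> R) (A : set R) :
  (forall u, 0 <= K u) -> 0 < h ->
  (forall z, A z -> kappa <= K ((z - x) / h)) ->
  kappa / h * \sum_(i < n) (v i \in A)%:R <=
  \sum_(k < n) scaled_kernel K h (v k - x).
Proof.
move=> K0 h0 KA; rewrite mulr_sumr; apply: ler_sum => i _.
case: (boolP (v i \in A)) => [/set_mem/KA KAi|_]; last by rewrite mulr0 scaled_kernel_ge0.
by rewrite mulr1 ler_pM2r ?invr_gt0.
Qed.

(** * Kernels and cells *)

Lemma pdf_gt0_point (R : realType) (K : R -> R) :
  is_pdf K -> exists u, 0 < K u.
Proof.
move=> [_ K0 K1]; apply/not_existsP => Kle.
have : (\int[lebesgue_measure]_x (K x)%:E = 0)%E.
  apply: integral0_eq => x _; congr EFin; apply/eqP.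
  by rewrite eq_le K0 andbT leNgt; apply/negP.
by rewrite K1 => /eqP; rewrite onee_eq0.
Qed.

Lemma lipschitz_modulus (R : realType) (K : R -> R) : lipschitz K ->
  exists2 L, 0 < L & forall u v, `|K u - K v| <= L * `|u - v|.
Proof.
case=> M [_ KM]; exists (Num.max (M + 1) 1); first by rewrite lt_max ltr01 orbT.
move=> u v; apply: (KM _ _ (u, v)) => //=.
by rewrite lt_max ltrDl ltr01.
Qed.

Section kernel.
Variables (R : realType) (K : R -> R).
Hypotheses (K_pdf : is_pdf K) (K_lip : lipschitz K)
  (K_support : forall u, u \notin `[-1, 1] -> K u = 0).

Lemma kernel_bounded : exists2 B, 0 < B & forall u, K u <= B.
Proof.
have [L L0 KL] := lipschitz_modulus K_lip.
(* A point of [-1, 1] is at distance at most 3 from 2, where K vanishes. *)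
exists (3 * L) => [|u]; first by rewrite mulr_gt0.
have [u1|u1] := boolP (u \in `[-1, 1]); last by rewrite K_support// mulr_ge0// ltW.
have K2 : K 2 = 0 by apply: K_support; apply/negP; rewrite in_itv/=; lra.
have := KL u 2; rewrite K2 subr0 mulrC => Kle.
apply: (le_trans (ler_norm _)); apply: (le_trans Kle).
rewrite ler_pM2r// ler_norml; move: u1; rewrite in_itv/=; lra.
Qed.

(** [K] integrates to 1, so it is positive somewhere, and its Lipschitz modulus
    keeps it above half that value on a ball. The symmetric ball is needed for
    points [x] near the right end of [0, 1], whose neighbourhood is seen by the
    design on the left only. *)
Lemma kernel_bump : (forall u, K (- u) = K u) ->
  exists u0 kappa delta, [/\ 0 <= u0 <= 1, 0 < kappa, 0 < delta &
    forall u, `|u - u0| <= delta \/ `|u + u0| <= delta -> kappa <= K u].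
Proof.
move=> K_sym; have [L L0 KL] := lipschitz_modulus K_lip.
have [a Ka] := pdf_gt0_point K_pdf.
have Ka' : K `|a| = K a by case: (ler0P a) => // _; rewrite K_sym.
exists `|a|, (K a / 2), (K a / (2 * L)); split.
- rewrite normr_ge0/= leNgt; apply/negP => a1.
  move: Ka; rewrite K_support ?ltxx// in_itv/=.
  by apply/negP => a1'; move: a1; rewrite ltNge ler_norml a1'.
- by rewrite divr_gt0.
- by rewrite divr_gt0// mulr_gt0.
have bump u : `|u - `|a| | <= K a / (2 * L) -> K a / 2 <= K u.
  move=> ua; have := KL u `|a|; rewrite Ka' => /ler_normlP[Kle _].
  have : L * `|u - `|a| | <= K a / 2.
    rewrite (le_trans (ler_wpM2l (ltW L0) ua))// le_eqVlt; apply/orP; left.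
    by apply/eqP; field; rewrite gt_eqF.
  by lra.
move=> u [ua|ua]; first exact: bump.
rewrite -(K_sym u); apply: bump.
by rewrite -opprD normrN.
Qed.

End kernel.

Section cells.
Variable R : realType.

Definition cell (m k : nat) : set R := `[k%:R / m%:R, k.+1%:R / m%:R].

Lemma cell_cover (m : nat) (y : R) : (0 < m)%N -> 0 <= y <= 1 ->
  exists2 k, (k < m)%N & cell m k y.
Proof.
move=> m0 /andP[y0 y1]; have m0' : 0 < m%:R :> R by rewrite ltr0n.
have [y1'|] := ltP y 1; last first.
  move=> y1'; have -> : y = 1 by apply/eqP; rewrite eq_le y1.
  exists m.-1; first by rewrite prednK.
  rewrite /cell /= in_itv/= prednK// divff ?gt_eqF// lexx andbT.
  by rewrite ler_pdivrMr// mul1r ler_nat leq_pred.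
have my0 : 0 <= y * m%:R by rewrite mulr_ge0// ltW.
have /andP[le_t lt_t] := truncn_itv my0.
exists (Num.truncn (y * m%:R)).
  by rewrite -(ltr_nat R) (le_lt_trans le_t)// gtr_pMl.
by rewrite /cell /= in_itv/= ler_pdivrMr// le_t ler_pdivlMr// ltW.
Qed.

Lemma cell_diam (m k : nat) (y z : R) : cell m k y -> cell m k z ->
  `|z - y| <= m%:R^-1.
Proof.
rewrite /cell /= !in_itv/= -natr1 mulrDl mul1r => /andP[? ?] /andP[? ?].
by rewrite ler_norml; lra.
Qed.

Lemma cell_sub01 (m k : nat) (y : R) : (k < m)%N -> cell m k y -> 0 <= y <= 1.
Proof.
move=> km; have m0 : 0 < m%:R :> R by rewrite ltr0n (leq_ltn_trans _ km).
rewrite /cell /= in_itv/= => /andP[y0 y1]; apply/andP; split.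
  by rewrite (le_trans _ y0)// divr_ge0.
by rewrite (le_trans y1)// ler_pdivrMr// mul1r ler_nat.
Qed.

(** Boundary points are handled by looking inwards: to the right of [x] when
    [x <= 1 / 2] and to the left otherwise. As [h u0 <= 1 / 2], the point
    [x + h u0] or [x - h u0] then lies in [0, 1], hence in a cell, and that cell
    is short enough to fit in the ball of radius [delta h] around it. *)
Lemma cell_kernel_ge (K : R -> R) (h u0 kappa delta : R) (m : nat) (x : R) :
  (forall u, `|u - u0| <= delta \/ `|u + u0| <= delta -> kappa <= K u) ->
  0 <= u0 <= 1 -> 0 < h <= 1 / 2 -> (0 < m)%N -> m%:R^-1 <= delta * h ->
  0 <= x <= 1 ->
  exists2 k, (k < m)%N & forall z, cell m k z -> kappa <= K ((z - x) / h).
Proof.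
move=> Kk /andP[u00 u01] /andP[h0 h1] m0 md x01.
have hu0 : 0 <= h * u0 by rewrite mulr_ge0// ltW.
have hu1 : h * u0 <= 1 / 2 by rewrite -[leRHS]mulr1 ler_pM// ltW.
have close y z k : cell m k y -> cell m k z -> `|z - y| / h <= delta.
  by move=> my mz; rewrite ler_pdivrMr// (le_trans (cell_diam my mz)).
have normE y u : `|(y - x) / h + u| = `|y - (x - h * u)| / h.
  have -> : (y - x) / h + u = (y - (x - h * u)) / h by field; rewrite gt_eqF.
  by rewrite normf_div (gtr0_norm h0).
have [xle|xgt] := leP x (1 / 2).
  have [|k km my] := @cell_cover m (x + h * u0) m0; first by lra.
  exists k => // z mz; apply: Kk; left.
  by rewrite normE mulrN opprK; exact: close my mz.
have [|k km my] := @cell_cover m (x - h * u0) m0; first by lra.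
exists k => // z mz; apply: Kk; right.
by rewrite normE; exact: close my mz.
Qed.

End cells.

(** * Cell probabilities and the choice of the number of cells *)

Lemma density_mass_ge d (T : measurableType d) (R : realType)
    (P : probability T R) (X : {RV P >-> R}) (f : R -> R) (a b c : R) :
  has_density X f -> a <= b -> 0 <= c -> (forall x, a <= x <= b -> c <= f x) ->
  ((c * (b - a))%:E <= P (X @^-1` `[a, b]))%E.
Proof.
move=> [[mf f0 _] Xf] ab c0 cf.
have -> : P (X @^-1` `[a, b]) = distribution P X `[a, b] by [].
rewrite Xf//; apply: (@le_trans _ _ (\int[lebesgue_measure]_(x in `[a, b]) cst c%:E x)%E).
  rewrite integral_cst//= lebesgue_measure_itv/= lte_fin EFinM.
  case: ltP => [//|ba]; have -> : b = a by apply/eqP; rewrite eq_le ab ba.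
  by rewrite subrr.
apply: ge0_le_integral => //=.
by apply/measurable_realfun.measurable_EFinP; exact: measurable_funTS.
Qed.

Lemma density_outside_support d (T : measurableType d) (R : realType)
    (P : probability T R) (X : {RV P >-> R}) (f : R -> R) (A : set R) :
  has_density X f -> measurable A -> (forall x, A x -> f x = 0) ->
  P (X @^-1` A) = 0%E.
Proof.
move=> [_ Xf] mA fA; have -> : P (X @^-1` A) = distribution P X A by [].
by rewrite Xf//; apply: integral0_eq => x /fA ->.
Qed.

(** With [m] the least integer above [1 / (delta h)], the mesh [1 / m] is
    comparable to [h]. From [n h >= A ln n] with [A >= 1] follows [m <= 2 n / delta],
    and from [A >= 2 / g] that [expR (- g n h) <= n^-2], so that the union bound
    is at most [2 / (delta n)]. *)
Lemma cells_vs_bandwidth (R : realType) (h : nat -> R) (g delta eps : R) :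
  0 < g -> 0 < delta -> 0 < eps -> (forall n, 0 < h n) ->
  h n @[n --> \oo] --> 0 -> n%:R * h n / ln n%:R @[n --> \oo] --> +oo ->
  \forall n \near \oo, [/\ (0 < n)%N, h n <= 1 / 2 & exists m : nat,
    [/\ (0 < m)%N, m%:R^-1 <= delta * h n, delta * h n <= 2 / m%:R &
        m%:R * expR (- (g * (n%:R * h n))) <= eps]].
Proof.
move=> g0 d0 e0 h0 h_cvg0 /cvgryPge h_rate.
pose A := Num.max 1 (2 / g).
(* The bound expR 1 gives ln n >= 1; the other one makes 2 / (delta n) <= eps. *)
pose N := Num.max (expR 1) (2 / (delta * eps)).
pose H := Num.min (1 / 2) (1 / delta).
have H0 : 0 < H by rewrite lt_min !divr_gt0.
near=> n.
have h_small : h n < H.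
  rewrite -(gtr0_norm (h0 n)); near: n.
  by move/cvgr0Pnorm_lt : h_cvg0; exact.
have nN : N <= n%:R by near: n; exact: nbhs_infty_ger.
have Anh : A <= n%:R * h n / ln n%:R by near: n; exact: h_rate.
move: h_small nN Anh; rewrite lt_min !ge_max.
move=> /andP[h12 hd] /andP[n_e n_eps] /andP[nh1 nhg].
have n0 : 0 < n%:R :> R by exact: lt_le_trans n_e.
have ln1 : 1 <= ln (n%:R : R) by rewrite -ler_expR lnK.
have ln0 : 0 < ln (n%:R : R) by exact: lt_le_trans ln1.
have nh_ge1 : 1 <= n%:R * h n.
  by move: nh1; rewrite ler_pdivlMr// mul1r; exact: le_trans.
have nh_ln : 2 * ln n%:R <= g * (n%:R * h n).
  by move: nhg; rewrite ler_pdivlMr// mulrAC ler_pdivrMr// [leRHS]mulrC.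
have dh0 : 0 < delta * h n by rewrite mulr_gt0.
have dh1 : delta * h n <= 1 by rewrite mulrC -ler_pdivlMr// ltW.
split; [by rewrite -(ltr_nat R) | exact: ltW |].
have idh0 : 0 <= (delta * h n)^-1 by rewrite invr_ge0 ltW.
have /andP[mle mgt] := truncn_itv idh0.
exists (Num.truncn (delta * h n)^-1).+1.
set m := (Num.truncn _).+1%:R in mgt *.
have m0 : 0 < m by rewrite ltr0n.
have dhm : delta * h n <= 2 / m.
  rewrite ler_pdivlMr// /m -natr1 mulrDr mulr1.
  have : delta * h n * (Num.truncn (delta * h n)^-1)%:R <= 1.
    by rewrite mulrC -ler_pdivlMr// mul1r.
  by lra.
split => //; first by rewrite invf_ple ?posrE// ltW.
have m_le : m <= 2 / delta * n%:R.
  have hinv : (h n)^-1 <= n%:R by rewrite invf_ple ?posrE// -ler_pdivrMl// mulr1 in nh_ge1 *.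
  move: dhm; rewrite ler_pdivlMr// => dhm.
  have : m <= 2 / delta * (h n)^-1.
    by rewrite -mulrA -invfM ler_pdivlMr// mulrC.
  move=> /le_trans; apply; by rewrite ler_wpM2l// divr_ge0// ltW.
have exp_le : expR (- (g * (n%:R * h n))) <= n%:R^-1 * n%:R^-1.
  apply: (@le_trans _ _ (expR (- (2 * ln n%:R)))); first by rewrite ler_expR lerN2.
  by rewrite expRN -invfM mulr_natl mulr2n expRD lnK// posrE.
apply: (@le_trans _ _ (2 / delta * n%:R * (n%:R^-1 * n%:R^-1))).
  by rewrite ler_pM ?expR_ge0// ltW.
have -> : 2 / delta * n%:R * (n%:R^-1 * n%:R^-1) = 2 / delta / n%:R.
  by field; rewrite !gt_eqF.
rewrite ler_pdivrMr// [leRHS]mulrC -ler_pdivrMr//.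
by move: n_eps; rewrite invfM mulrA.
Unshelve. all: by end_near. Qed.

(** * Uniform lower bound on the denominators, and conclusion *)

(** The uncountable family of events indexed by [x] is covered by the finitely
    many events that a cell is underpopulated, to which the Chernoff bound and
    the union bound apply. *)
Lemma nw_denominator_whp d (T : measurableType d) (R : realType)
    (P : probability T R) (X : nat -> {RV P >-> R}) (f K : R -> R)
    (h : nat -> R) (c : R) :
  independent_RVs X -> (forall i, has_density (X i) f) ->
  0 < c -> (forall x, 0 <= x <= 1 -> c <= f x) ->
  is_pdf K -> (forall u, K (- u) = K u) -> lipschitz K ->
  (forall u, u \notin `[-1, 1] -> K u = 0) ->
  (forall n, 0 < h n) -> h n @[n --> \oo] --> 0 ->
  n%:R * h n / ln n%:R @[n --> \oo] --> +oo ->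
  exists2 a, 0 < a & forall eps, 0 < eps -> \forall n \near \oo,
    ((P^*)%mu [set o | exists2 x : R, (0 <= x <= 1)%R &
       (\sum_(k < n) scaled_kernel K (h n) (X k o - x) < a * n%:R)%R]
     <= eps%:E)%E.
Proof.
move=> indep dens c0 cf K_pdf K_sym K_lip K_supp h0 h_cvg0 h_rate.
have [_ K0 _] := K_pdf.
have [u0 [kappa [delta [u01 k0 d0 Kk]]]] := kernel_bump K_pdf K_lip K_supp K_sym.
(* A cell has mass p >= c / m >= c delta h / 2, so that n p / 2 >= 2 g n h: the
   threshold t = g n h leaves an exponent t - n p / 2 <= - t. *)
pose g := c * delta / 8.
have g0 : 0 < g by rewrite divr_gt0// mulr_gt0.
exists (kappa * g) => [|eps e0]; first by rewrite mulr_gt0.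
have := cells_vs_bandwidth g0 d0 e0 h0 h_cvg0 h_rate.
apply: filterS => n [n0 h12 [m [m0 m_le le_m union_le]]].
have m0' : 0 < m%:R :> R by rewrite ltr0n.
set t := g * (n%:R * h n).
have cover : [set o | exists2 x, 0 <= x <= 1 &
    \sum_(k < n) scaled_kernel K (h n) (X k o - x) < kappa * g * n%:R] `<=`
    \big[setU/set0]_(k < m) [set o | hits X n (cell m k) o <= t].
  move=> o /= [x x01 sparse].
  have [|k km K_cell] := cell_kernel_ge (m := m) Kk u01 _ m0 m_le x01.
    by rewrite h0.
  rewrite -bigcup_seq; exists (Ordinal km) => /=; first exact: mem_index_enum.
  rewrite leNgt; apply/negP => many.
  move: sparse; rewrite ltNge => /negP; apply.
  apply: le_trans (nw_denominator_ge _ K0 (h0 n) K_cell).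
  apply: (@le_trans _ _ (kappa / h n * t)).
    rewrite le_eqVlt; apply/orP; left; apply/eqP; rewrite /t.
    by field; rewrite gt_eqF.
  by rewrite ler_pM2l ?divr_gt0// ltW.
apply: (le_trans (le_mu_ext P cover)).
apply: (le_trans (outer_measure_subadditive _
  (fun k => [set o | hits X n (cell m k) o <= t]) m)).
apply: (@le_trans _ _ (\sum_(k < m) (expR (- t))%:E)%E); last first.
  by rewrite sumEFin lee_fin sumr_const card_ord -mulr_natl.
apply: lee_sum => k _.
apply: (le_trans (hits_lower_tail (p := c / m%:R) n t indep _ _)).
- exact: measurable_itv.
- move=> i; apply: le_trans (density_mass_ge (dens i) _ (ltW c0) _).
  + by rewrite -mulrBl -natr1 addrAC subrr add0r div1r.
  + by rewrite ler_pM2r ?invr_gt0// ler_nat.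
  + by move=> x xk; apply: cf; apply: (@cell_sub01 _ m k) => //; rewrite /cell/= in_itv.
rewrite lee_fin ler_expR.
suff : 2 * t <= n%:R * (c / m%:R) / 2 by lra.
have -> : 2 * t = n%:R * c / 4 * (delta * h n) by rewrite /t /g; field.
have -> : n%:R * (c / m%:R) / 2 = n%:R * c / 4 * (2 / m%:R).
  by field; rewrite gt_eqF.
by rewrite ler_wpM2l// divr_ge0// mulr_ge0// ltW.
Qed.

Theorem theorem1 (R : realType) (d : measure_display) (T : measurableType d)
    (P : probability T R)
    (X : nat -> {RV P >-> R}) (f : R -> R)
    (X_indep : independent_RVs X)
    (X_density : forall i, has_density (X i) f)
    (f_support : forall x, x \notin `[0, 1] -> f x = 0)
    (f_cont : {within `[0, 1], continuous f})
    (f_inf : 0 < inf [set f x | x in `[0, 1]])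
    (K : R -> R)
    (K_pdf : is_pdf K)
    (K_sym : forall u, K (- u) = K u)
    (K_lip : lipschitz K)
    (K_support : forall u, u \notin `[-1, 1] -> K u = 0)
    (h : nat -> R)
    (h_gt0 : forall n, 0 < h n)
    (h_cvg0 : h n @[n --> \oo] --> 0)
    (h_rate : n%:R * h n / ln n%:R @[n --> \oo] --> +oo)
    (* [w n v j] is the j-th weight function computed from the sample v *)
    (w : forall n : nat, ('I_n -> R) -> 'I_n -> R -> R)
    (w_sum1 : forall n, (0 < n)%N ->
       \forall o \ae P, forall x, x \in `[0, 1] ->
         \sum_(j < n) w n (fun i => X i o) j x = 1) :
  bigO_p P (fun n o => sup_sum_sq (w n (fun i => X i o)))
    (fun n => n%:R^-1 * (h n)^-1) ->
  bigO_p P (fun n o => sup_sum_sq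
      (boosted_weight K (h n) (fun i : 'I_n => X i o) (w n (fun i => X i o))))
    (fun n => n%:R^-1 * (h n)^-1).
Proof.
move=> w_O eps eps0.
have [_ K0 _] := K_pdf.
have [B B0 KB] := kernel_bounded K_lip K_support.
have f_ge x : 0 <= x <= 1 -> inf [set f x | x in `[0, 1]] <= f x.
  move=> x01; apply: ge_inf; last by exists x => //=; rewrite in_itv.
  by have [[_ f0 _] _] := X_density 0%N; exists 0 => _ [y _ <-].
have [a a0 denom] := nw_denominator_whp X_indep X_density f_inf f_ge
  K_pdf K_sym K_lip K_support h_gt0 h_cvg0 h_rate.
have eps2 : 0 < eps / 2 by rewrite divr_gt0.
have [M M0 w_le] := w_O _ eps2.
exists (3 * (B / a) + 6 * M).
  by rewrite addr_gt0// mulr_gt0// divr_gt0.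
apply: filterS3 (nbhs_infty_gt 0) w_le (denom _ eps2) => n n_gt0 W_le D_le.
have n0 : 0 < n%:R :> R by rewrite ltr0n.
set r := n%:R^-1 * (h n)^-1.
pose W := [set o | (M * r)%:E < `|sup_sum_sq (w n (fun i => X i o))|]%E.
pose D := [set o | exists2 x, 0 <= x <= 1 &
  \sum_(k < n) scaled_kernel K (h n) (X k o - x) < a * n%:R].
pose Out := \big[setU/set0]_(i < n) (X i @^-1` (~` `[0, 1])).
have Out0 : ((P^*)%mu Out <= 0)%E.
  apply: (le_trans (outer_measure_subadditive _ (fun i => X i @^-1` (~` `[0, 1])) n)).
  rewrite big1// => i _.
  transitivity (P^*%mu (X i @^-1` (~` `[0, 1]))) => //.
  have mC : measurable (~` `[0, 1] : set R) by exact: measurableC.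
  rewrite measurable_mu_extE; last first.
    by rewrite -[_ @^-1` _]setTI; exact: measurable_funP.
  apply: (density_outside_support (X_density i)) => // x x01.
  by apply: f_support; apply/negP.
(* W: the bound on the initial weights fails; D: some denominator is too small;
   Out: some sample point leaves [0, 1]. *)
have cover : [set o | ((3 * (B / a) + 6 * M) * r)%:E < `|sup_sum_sq
    (boosted_weight K (h n) (fun i : 'I_n => X i o) (w n (fun i => X i o)))|]%E
    `<=` (W `|` D) `|` Out.
  move=> o /=; apply: contraPP => nU; apply/negP; rewrite -leNgt.
  have nW : ~ W o by move=> Wo; apply: nU; left; left.
  have nD : ~ D o by move=> Do; apply: nU; left; right.
  have nOut : ~ Out o by move=> Oo; apply: nU; right.
  have X01 (i : 'I_n) : 0 <= X i o <= 1.
    apply: contrapT => Xi; apply: nOut; rewrite /Out -bigcup_seq.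
    exists i; first exact: mem_index_enum.
    by rewrite /preimage/= in_itv/=.
  have w_bound y : 0 <= y <= 1 ->
      \sum_(j < n) w n (fun i => X i o) j y ^+ 2 <= M * r.
    move=> y01; rewrite -lee_fin; move/negP: nW; rewrite -leNgt; apply: le_trans.
    apply: le_trans (lee_abs _); apply: ereal_sup_ubound.
    by exists y => //=; rewrite in_itv.
  have boosted_le x : 0 <= x <= 1 -> \sum_(j < n) boosted_weight K (h n)
      (fun i : 'I_n => X i o) (w n (fun i => X i o)) j x ^+ 2 <=
      (3 * (B / a) + 6 * M) * r.
    move=> x01.
    have -> : (3 * (B / a) + 6 * M) * r =
        3 * (B / (h n * (a * n%:R))) + 6 * (M * r).
      by rewrite /r; field; rewrite !gt_eqF.
    apply: sum_sqr_boosted_weight_le => //; first by rewrite mulr_gt0.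
    by rewrite leNgt; apply/negP => Dx; apply: nD; exists x.
  rewrite gee0_abs.
    apply: ge_ereal_sup => _ [x + <-]; rewrite /= in_itv/= lee_fin.
    exact: boosted_le.
  apply: (@le_trans _ _ (\sum_(j < n) boosted_weight K (h n)
      (fun i : 'I_n => X i o) (w n (fun i => X i o)) j 0 ^+ 2)%:E).
    by rewrite lee_fin sumr_ge0// => j _; exact: sqr_ge0.
  by apply: ereal_sup_ubound; exists 0 => //=; rewrite in_itv/= lexx ler01.
apply: (le_trans (le_mu_ext P cover)).
apply: (le_trans (outer_measureU2 _ _ _)).
rewrite -[eps%:E]adde0; apply: leeD => //.
apply: (le_trans (outer_measureU2 _ _ _)).
have -> : eps%:E = ((eps / 2)%:E + (eps / 2)%:E)%E by rewrite -EFinD -splitr.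
exact: leeD.
Qed.
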